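(* Let $\{T_t\}_{t\ge 0}$ be a Feller semigroup in $C_\infty(\Omega)$ with generator $A$. Let $B$ be a dense subspace of $C_\infty(\Omega)$, contained in the domain of $A$ and invariant under every $T_t$, such that $B$ is itself a normed space under a norm $\|\cdot\|_B$ and $$\|T_tf\|_B\le c(t)\|f\|_B\qquad\text{for all } f\in B,\ t\ge 0,$$ for some non-decreasing continuous function $c(t)$ on $\mathbb{R}_+$. For each $h>0$ let $\{T^h_t\}_{t\ge0}$ be a Feller semigroup in $C_\infty(\Omega_h)$ with generator $A_h$ whose domain contains $\pi_hB$, and such that $$\|(A_h\pi_h-\pi_hA)f\|\le\omega(h)\|f\|_B\qquad\text{for all } f\in B,$$ where $\omega(h)\in(0,1)$ and $\omega(h)\to0$ as $h\to0$. Let $\alpha\in(0,1)$. Then: 1. For any $t>0$ and $f\in C_\infty(\Omega)$, the sequence $T^h_sf$ converges to $T_sf$ as $h\to0$ uniformly for $s\in[0,t]$, in the sense that $$\sup_{s\le t}\|(T^h_s\pi_h-\pi_hT_s)f\|\to0,\qquad h\to0.$$ 2. If $f\in B$, then for any $t>0$ $$\sup_{s\le t}\|(T^h_s\pi_h-\pi_hT_s)f\|\le\omega(h)\|f\|_B\int_0^tc(s)\,ds.$$ 3. If $\|T_t\|_B\le Me^{mt}$ for all $t\ge0$ with $M\ge1$ and $m\le0$, then for $f\in B$ $$\|((-A_h)^\alpha\pi_h-\pi_h(-A)^\alpha)f\|\le C_1\|f\|_B\,\omega^\alpha(h),$$ where $C_1=C_1(M,\alpha)$ is some constant. 4. If $\|T_t\|_B\le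 Me^{mt}$ for all $t\ge0$ with $M\ge1$ and $m>0$, then for $f\in B$ $$\|((-A_h)^\alpha\pi_h-\pi_h(-A)^\alpha)f\|\le C_2\|f\|_B\left(\ln\frac1{\omega(h)}\right)^{-\alpha},$$ where $C_2=C_2(M,m,\alpha)$ is some constant. 5. If $\|T_t\|_B\le M(1+t^p)$ for all $t\ge0$ with $p>0$, then for $f\in B$ $$\|((-A_h)^\alpha\pi_h-\pi_h(-A)^\alpha)f\|\le C_3\,\omega^{\frac{\alpha}{p+1}}(h)\,\|f\|_B,$$ where $C_3=C_3(M,p,\alpha)$ is some constant.
   Context: $\Omega$ is a locally compact separable metric space; for each $h>0$, $\Omega_h\subset\Omega$ is a closed subset. $C_\infty(\Omega)$ is the space of bounded continuous functions $f$ on $\Omega$ vanishing at infinity (for every $\varepsilon>0$ there is a compact $K$ with $\sup_{x\notin K}|f(x)|<\varepsilon$), with the sup-norm $\|\cdot\|$; likewise for $C_\infty(\Omega_h)$. The map $\pi_h:C_\infty(\Omega)\to C_\infty(\Omega_h)$ is restriction to $\Omega_h$. A Feller semigroup on $C_\infty(\Omega)$ is a semigroup $\{T_t\}_{t\ge0}$ of positive linear contractions mapping $C_\infty(\Omega)$ to itself with $\|T_tf-f\|\to0$ as $t\downarrow0$ for every $f\in C_\infty(\Omega)$. $\|T_t\|_B$ denotes the operator norm of the restriction of $T_t$ to $(B,\|\cdot\|_B)$. For a strongly continuous contraction semigroup $\{T_t\}$ with generator $A$ and $0<\alpha<1$, the fractional power is defined (Balakrishnan) by $$(-A)^\alpha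 f=\frac1{\Gamma(-\alpha)}\int_0^\infty t^{-\alpha-1}(T_t-I)f\,dt,\qquad f\in D(A),$$ and $(-A_h)^\alpha$ is defined in the same way from $T^h_t$.
   Formalization: In items 3, 4 and 5 it is additionally assumed that ‖f‖ ≤ ‖f‖_B for all f in B; without a lower bound of this kind on ‖·‖_B these items fail (two-point Ω, T_t = I, ‖·‖_B = λ‖·‖ with λ → 0). *)

(* Defs.v *)
From HB Require Import structures.
From mathcomp Require Import all_boot all_order all_algebra.
From mathcomp Require Import all_classical all_reals all_analysis.

Set Implicit Arguments.
Unset Strict Implicit.
Unset Printing Implicit Defensive.

Import Order.TTheory GRing.Theory Num.Theory.
Import numFieldNormedType.Exports.

Local Open Scope classical_set_scope.
Local Open Scope ring_scope.

Section C0_space.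
Context (X : topologicalType) (R : realType).
Implicit Types f g : X -> R.

Definition vanishes_at_infinity f :=
  forall e : R, 0 < e ->
    exists2 K : set X, compact K & forall x, ~ K x -> `|f x| < e.

Definition is_C0 f :=
  [/\ continuous f, bounded_fun f & vanishes_at_infinity f].

Definition C0_pred : {pred X -> R} := fun f => `[< is_C0 f >].

Lemma bounded_funE f :
  bounded_fun f <-> exists M : R, forall x, `|f x| <= M.
Proof.
split=> [[M [Mreal HM]]|[M HM]].
  exists (M + 1) => x; exact: (HM (M + 1) (ltr_pwDr ltr01 (lexx _))).
exists M; split; first exact: num_real.
by move=> N MN x _; apply: le_trans (HM x) (ltW MN).
Qed.

Lemma C0_submod_closed : submod_closed C0_pred.
Proof.
split.
  apply/asboolP; split.
  - by move=> x; exact: cst_continuous.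
  - by apply/bounded_funE; exists 0 => x; rewrite normr0.
  - move=> e e0; exists set0; first exact: compact0.
    by move=> x _; rewrite normr0.
move=> a f g /asboolP[cf /bounded_funE[M fM] f0] /asboolP[cg /bounded_funE[N gN] g0].
apply/asboolP; split.
- by move=> x; apply: cvgD; [apply: cvgM; [exact: cvg_cst|exact: cf]|exact: cg].
- apply/bounded_funE; exists (`|a| * M + N) => x.
  by rewrite (le_trans (ler_normD _ _))// normrM lerD// ler_wpM2l.
- move=> e e0.
  have e20 : 0 < e / 2 by rewrite divr_gt0.
  have ea0 : 0 < e / 2 / (`|a| + 1) by rewrite divr_gt0// ltr_wpDl.
  have [K cK fK] := f0 _ ea0; have [L cL gL] := g0 _ e20.
  exists (K `|` L); first exact: compactU.
  move=> x /not_orP[nK nL].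
  rewrite (le_lt_trans (ler_normD _ _))// [e]splitr ltr_leD//; last first.
    exact/ltW/gL.
  rewrite normrM; have := fK _ nK.
  rewrite ltr_pdivlMr ?ltr_wpDl// => /(le_lt_trans _); apply.
  by rewrite mulrC ler_wpM2l// lerDl.
Qed.

Record C0 := MkC0 { C0_fun :> X -> R; C0_funP : C0_fun \in C0_pred }.

HB.instance Definition _ := [isSub for C0_fun].
HB.instance Definition _ := [Choice of C0 by <:].
HB.instance Definition _ :=
  GRing.isSubmodClosed.Build R (X -> R) C0_pred C0_submod_closed.
HB.instance Definition _ := [SubChoice_isSubLmodule of C0 by <:].

Implicit Types u v : C0.

(* The supremum of the empty set is 0, so this is also right for X empty. *)
Definition C0_norm u : R := sup [set `|u x| | x in [set: X]].

Lemma C0P u : is_C0 u. Proof. exact/asboolP/C0_funP. Qed.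

Lemma C0_ext u v : (forall x, u x = v x) -> u = v.
Proof. by move=> uv; apply/val_inj/funext. Qed.

Lemma C0_norm_ub u x : `|u x| <= C0_norm u.
Proof.
apply: ub_le_sup; last by exists x.
have [_ /bounded_funE[M uM] _] := C0P u.
by exists M => _ [y _ <-].
Qed.

Lemma C0_norm_ge0 u : 0 <= C0_norm u.
Proof.
have [[x _]|/forallNP X0] := pselect (exists x : X, True).
  exact: le_trans (C0_norm_ub u x).
rewrite /C0_norm (_ : [set _ | _ in _] = set0) ?sup0//.
by apply/seteqP; split=> [z [y _ _]|z //]; case: (X0 y).
Qed.

Lemma C0_norm_le u (M : R) : 0 <= M -> (forall x, `|u x| <= M) -> C0_norm u <= M.
Proof.
move=> M0 uM; rewrite /C0_norm.
have [->|/set0P n0] := eqVneq [set `|u x| | x in [set: X]] set0.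
  by rewrite sup0.
by apply: ge_sup => // _ [y _ <-].
Qed.

Lemma C0_ler_normD u v : C0_norm (u + v) <= C0_norm u + C0_norm v.
Proof.
apply: C0_norm_le => [|x]; first by rewrite addr_ge0// C0_norm_ge0.
by rewrite (le_trans (ler_normD _ _))// lerD// C0_norm_ub.
Qed.

Lemma C0_norm_scale_le a u : C0_norm (a *: u) <= `|a| * C0_norm u.
Proof.
apply: C0_norm_le => [|x]; first by rewrite mulr_ge0// C0_norm_ge0.
by rewrite normrM ler_wpM2l// C0_norm_ub.
Qed.

Lemma C0_normrZ a u : C0_norm (a *: u) = `|a| * C0_norm u.
Proof.
apply/eqP; rewrite eq_le C0_norm_scale_le/=.
have [->|a0] := eqVneq a 0; first by rewrite normr0 mul0r C0_norm_ge0.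
rewrite -ler_pdivlMl ?normr_gt0// -normfV.
by apply: le_trans (C0_norm_scale_le _ _); rewrite scalerA mulVf// scale1r.
Qed.

Lemma C0_normr0_eq0 u : C0_norm u = 0 -> u = 0.
Proof.
move=> u0; apply: C0_ext => x; apply/normr0_eq0/le_anti.
by rewrite normr_ge0 andbT -u0 C0_norm_ub.
Qed.

HB.instance Definition _ :=
  Lmodule_isNormed.Build R C0 C0_ler_normD C0_normrZ C0_normr0_eq0.

End C0_space.

Section restriction.
Context (R : realType) (X : topologicalType) (D : set X).

(* [C0_restrict D f] is the restriction of [f] whenever that is an element of
   [C0 D R], in particular for closed [D] (see [C0_restrictE]), and 0 otherwise. *)
Definition C0_restrict (f : C0 X R) : C0 D R :=
  insubd (0 : C0 D R) (fun x : D => f (set_val x)).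

Lemma C0_restrict_subproof (f : C0 X R) : closed D -> is_C0 (fun x : D => f (set_val x)).
Proof.
move=> cD; have [cf bf f0] := C0P f; split.
- move=> x; apply: (@continuous_comp _ _ _ (set_val : D -> X) f); last exact: cf.
  exact: initial_continuous.
- move/bounded_funE : bf => [M fM]; apply/bounded_funE.
  by exists M => x; exact: fM.
- move=> e e0; have [K cK fK] := f0 _ e0.
  exists (set_val @^-1` K : set D); last by move=> x; exact: fK.
  move=> F PF FK.
  have [x [Kx Dx cx]] : exists x, [/\ K x, D x & cluster (set_val @ F) x].
    have FD : (set_val @ F) (K `&` D).
      rewrite /= nbhs_simpl; apply: filterS FK => y Ky; split => //.
      exact: set_valP.
    have [x [[Kx Dx] cx]] := compact_closedI cK cD _ FD.
    by exists x.
  exists (exist _ x (mem_set Dx)); split => // A B FA.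
  move=> [_ [] [W oW <-] /= Wx WB].
  have [||y [[z Az zy] Wy]] := cx (set_val @` A) W.
  - by apply: (@filterS _ F _ A) => // y Ay; exists y.
  - by apply: open_nbhs_nbhs; split => //; move: Wx; rewrite set_valE.
  by exists z; split => //; apply: WB; rewrite /= set_valE; move: zy; rewrite set_valE => ->.
Qed.

Lemma C0_restrictE (f : C0 X R) (x : D) :
  closed D -> C0_restrict f x = f (set_val x).
Proof.
by move=> cD; rewrite /C0_restrict val_insubd ifT//; apply/asboolP/C0_restrict_subproof.
Qed.

End restriction.

Section semigroups.
Context (R : realType).

Record feller_semigroup (X : topologicalType) (T : R -> C0 X R -> C0 X R) : Prop := {
  feller_linear : forall t : R, 0 <= t -> linear (T t) ;
  feller_id : forall f : C0 X R, T 0 f = f ;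
  feller_add : forall (s t : R) (f : C0 X R),
    0 <= s -> 0 <= t -> T (s + t) f = T s (T t f) ;
  feller_pos : forall (t : R) (f : C0 X R), 0 <= t ->
    (forall x, 0 <= f x) -> forall x, 0 <= T t f x ;
  feller_contraction : forall (t : R) (f : C0 X R),
    0 <= t -> `|T t f| <= `|f| ;
  feller_continuous : forall f : C0 X R,
    `|T t f - f| @[t --> 0^'+] --> (0 : R)
}.

Context (V : normedModType R).
Implicit Types (T : R -> V -> V) (f : V).

Definition generator_domain T : set V :=
  [set f | cvg (t^-1 *: (T t f - f) @[t --> 0^'+])].

Definition generator T f : V := lim (t^-1 *: (T t f - f) @[t --> 0^'+]).

Record normed_subspace (B : set V) (normB : V -> R) : Prop := {
  nsub0 : B 0 ;
  nsubD : forall f g, B f -> B g -> B (f + g) ;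
  nsubZ : forall (a : R) f, B f -> B (a *: f) ;
  nsub_normD : forall f g, B f -> B g -> normB (f + g) <= normB f + normB g ;
  nsub_normZ : forall (a : R) f, B f -> normB (a *: f) = `|a| * normB f ;
  nsub_norm0_eq0 : forall f, B f -> normB f = 0 -> f = 0
}.

Definition opnorm_on (B : set V) (normB : V -> R) (S : V -> V) : \bar R :=
  ereal_sup [set (normB (S f))%:E | f in [set f | B f /\ normB f <= 1]].

End semigroups.

Section bochner.
Context (R : realType) (V : normedModType R).
Context d (T : measurableType d) (mu : {measure set T -> \bar R}).

(* A V-valued simple function is given by the list of the pairs (A_i, v_i) of
   an expression \sum_i 1_(A_i) v_i, where the sets A_i may overlap. *)
Definition simple_on (D : set T) (s : seq (set T * V)) : Prop :=
  forall Av, Av \in s ->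
    [/\ measurable Av.1, Av.1 `<=` D & (mu Av.1 < +oo)%E].

Definition simple_eval (s : seq (set T * V)) (x : T) : V :=
  \sum_(Av <- s) (\1_(Av.1) x : R) *: Av.2.

Definition simple_integral (s : seq (set T * V)) : V :=
  \sum_(Av <- s) fine (mu Av.1) *: Av.2.

Definition is_bochner_integral (D : set T) (F : T -> V) (v : V) : Prop :=
  exists s : nat -> seq (set T * V),
    [/\ forall n, simple_on D (s n),
        {ae mu, forall x, D x -> simple_eval (s n) x @[n --> \oo] --> F x},
        (\int[mu]_(x in D) (`|F x - simple_eval (s n) x|)%:E)%E
          @[n --> \oo] --> (0 : \bar R) &
        simple_integral (s n) @[n --> \oo] --> v].

(* 0 when F is not Bochner integrable on D *)
Definition bochner_integral (D : set T) (F : T -> V) : V :=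
  xget 0 (is_bochner_integral D F).

End bochner.

Section fractional_power.
Context (R : realType).

Definition Euler_Gamma (z : R) : R :=
  \int[@lebesgue_measure R]_(x in `]0, +oo[) (x `^ (z - 1) * expR (- x)).

(* Euler's integral for z > 0, continued to the non-integral z < 0 by
   Gamma z = Gamma (z + n) / (z (z + 1) ... (z + n - 1)), 0 < z + n < 1. *)
Definition Gamma (z : R) : R :=
  let n := if 0 < z then 0%N else `|Num.floor z|%N in
  Euler_Gamma (z + n%:R) / \prod_(k < n) (z + k%:R).

(* (- A)^alpha f, where A is the generator of T *)
Definition fractional_power (V : normedModType R) (T : R -> V -> V) (alpha : R)
    (f : V) : V :=
  (Gamma (- alpha))^-1 *:
    bochner_integral (@lebesgue_measure R) `]0, +oo[
      (fun t : R => t `^ (- alpha - 1) *: (T t f - f)).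

End fractional_power.

(* Main.v *)
(* The error S_t pi f - pi T_t f is the increment of r |-> S_(t - r) pi T_r f over
   [0, t], and the generator estimate at T_r f bounds the growth of this path;
   this gives part 2, and part 1 follows by density. Evaluated at a point, the
   Balakrishnan integrals become Lebesgue integrals of real functions, so the
   error of the fractional powers is at most a constant times the integral of
   t^(-alpha-1) min(K t, N), where K t is the estimate of part 2 and N comes
   from contractivity. Splitting the integral at a time tau and taking
   tau = 1/omega, ln(1/omega)/(2m) and omega^(-1/(p+1)) gives parts 3, 4, 5. *)

Require Import Defs.
From HB Require Import structures.
From mathcomp Require Import all_boot all_order all_algebra.
From mathcomp Require Import all_classical all_reals all_analysis.
From mathcomp Require Import measurable_realfun ring lra.
Set Implicit Arguments.
Unset Strict Implicit.
Unset Printing Implicit Defensive.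
Import Order.TTheory GRing.Theory Num.Theory.
Import numFieldNormedType.Exports.
Local Open Scope classical_set_scope.
Local Open Scope ring_scope.

(** * Integrals of powers *)

(** The path in [C0] is never differentiated. Its growth is propagated by an induction over real
    time, with a small linear slack that absorbs the first-order remainders; at each time only the
    right derivative of the two semigroups at 0 and a limit from the left are used.

    [bochner_integral] is a choice with default value 0, so evaluating it at a point requires
    existence first. The candidate is the function of pointwise integrals. Integrals of simple
    functions approach it uniformly, because evaluation at a point is bounded by the norm, and a
    uniform limit stays in [C0].

    Let [M'] bound the operator norms of the semigroup on [B] over [[0, tau]]. The split at [tau]
    then gives the power [- alpha] of [tau], times a factor that involves omega only through
    [omega * M' * tau]. Each [tau] is chosen to keep this product bounded, with [M'] equal to [M],
    [M * expR (m * tau)] and [2 * M] times the power [p] of [tau]. The summands 2 in the numerators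
    of the constants come from [N = 2 * normB f]. *)

Section power_integrals.
Context {R : realType}.
Notation mu := (@lebesgue_measure R).
Implicit Types (s a b t x y M alpha K N tau : R).

Lemma powR_continuous_at s x :
  0 < x -> {for x, continuous (fun t : R => t `^ s)}.
Proof.
move=> x0; apply: differentiable_continuous; apply/derivable1_diffP.
by apply: derivable_powR; rewrite in_itv/= x0.
Qed.

Lemma integral_powR s a b : s + 1 != 0 -> 0 < a -> a < b ->
  (\int[mu]_(t in `[a, b]) (t `^ s)%:E
   = ((b `^ (s + 1) - a `^ (s + 1)) / (s + 1))%:E)%E.
Proof.
move=> s1 a0 ab.
pose F (t : R) := (s + 1)^-1 * t `^ (s + 1).
have dF (x : R) : 0 < x -> is_derive x (1 : R) F (x `^ s).
  move=> x0; have -> : x `^ s = (s + 1)^-1 * ((s + 1) * x `^ (s + 1 - 1)).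
    by rewrite mulKf// addrK.
  exact: (is_deriveZ (s + 1)^-1 (is_derive1_powR (s + 1) x0)).
have cF (x : R) : 0 < x -> {for x, continuous F}.
  move=> x0; apply: differentiable_continuous; apply/derivable1_diffP.
  by case: (dF _ x0).
rewrite (@continuous_FTC2 _ _ F)//.
- by rewrite -EFinB /F -mulrBr mulrC.
- apply: continuous_in_subspaceT => x /set_mem/=; rewrite in_itv/= => /andP[ax _].
  exact/powR_continuous_at/(lt_le_trans a0).
- split.
  + move=> x; rewrite in_itv/= => /andP[ax _].
    by case: (dF x (lt_trans a0 ax)).
  + exact/cvg_at_right_filter/cF.
  + exact/cvg_at_left_filter/cF/(lt_trans a0).
- move=> x; rewrite in_itv/= => /andP[ax _]; rewrite derive1E.
  by case: (dF x (lt_trans a0 ax)).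
Qed.

Let measurable_EFin_powR s (D : set (measurableTypeR R)) :
  measurable_fun D (fun t : measurableTypeR R => (t `^ s)%:E).
Proof. by apply/measurable_EFinP; apply: measurable_funTS. Qed.

(** No order between [a] and [b] is imposed, because the intervals that exhaust []0, b]] below are
    empty or a point as long as their left end is not smaller than [b]. *)
Let integral_powR_le s a b M : s + 1 != 0 -> 0 < a -> 0 <= M ->
  (b `^ (s + 1) - a `^ (s + 1)) / (s + 1) <= M ->
  (\int[mu]_(t in `[a, b]) (t `^ s)%:E <= M%:E)%E.
Proof.
move=> s1 a0 M0 le_M; case: (ltgtP a b) => ab.
- by rewrite integral_powR// lee_fin.
- by rewrite set_itv_ge ?integral_set0 ?lee_fin// bnd_simp -ltNge.
- by rewrite ab set_itv1 integral_set1 lee_fin.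
Qed.

(** Monotone convergence along the intervals from [1 / (n + 1)] to [b]: dropping the lower boundary
    term of the primitive makes the bound uniform in [n]. *)
Lemma integral_powR_zero s b : 0 < s + 1 -> 0 <= b ->
  (\int[mu]_(t in `]0%R, b]) (t `^ s)%:E <= (b `^ (s + 1) / (s + 1))%:E)%E.
Proof.
move=> s1 b0; rewrite itv_open_bnd_bigcup.
have := @ge0_nondecreasing_set_cvg_integral _ (measurableTypeR R) R
  (fun n : nat => `[0 + n.+1%:R^-1, b]%classic) (EFin \o @powR R ^~ s) mu.
have homoF : {homo (fun n : nat => `[0 + n.+1%:R^-1, b]%classic) :
    n m / (n <= m)%N >-> (n <= m)%O}.
  move=> n m nm; rewrite subsetEset; apply: subset_itvr.
  by rewrite bnd_simp ?lerD2l lef_pV2 ?posrE// ler_nat.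
move=> /(_ homoF (fun=> measurable_itv _) (fun=> @measurable_EFin_powR _ _)) intF.
rewrite -(cvg_lim (@ereal_hausdorff R) (intF _)); last first.
  by move=> n x _; rewrite lee_fin powR_ge0.
apply: lime_le => //.
  by apply/cvg_ex; eexists; apply: intF => n x _; rewrite lee_fin powR_ge0.
apply: nearW => n; apply: integral_powR_le => //; first by rewrite gt_eqF.
- by rewrite divr_ge0 ?powR_ge0// ltW.
- by rewrite ler_pM2r ?invr_gt0// gerBl powR_ge0.
Qed.

Lemma integral_powR_infty s a : s + 1 < 0 -> 0 < a ->
  (\int[mu]_(t in `[a, +oo[) (t `^ s)%:E <= (a `^ (s + 1) / - (s + 1))%:E)%E.
Proof.
move=> s1 a0; rewrite itv_bndy_bigcup_BRight.
have := @ge0_nondecreasing_set_cvg_integral _ (measurableTypeR R) R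
  (fun n : nat => `[a, a + n%:R]%classic) (EFin \o @powR R ^~ s) mu.
have homoF : {homo (fun n : nat => `[a, a + n%:R]%classic) :
    n m / (n <= m)%N >-> (n <= m)%O}.
  move=> n m nm; rewrite subsetEset; apply: subset_itvl.
  by rewrite bnd_simp lerD2l ler_nat.
move=> /(_ homoF (fun=> measurable_itv _) (fun=> @measurable_EFin_powR _ _)) intF.
rewrite -(cvg_lim (@ereal_hausdorff R) (intF _)); last first.
  by move=> n x _; rewrite lee_fin powR_ge0.
apply: lime_le => //.
  by apply/cvg_ex; eexists; apply: intF => n x _; rewrite lee_fin powR_ge0.
apply: nearW => n; apply: integral_powR_le => //; first by rewrite lt_eqF.
- by rewrite divr_ge0 ?powR_ge0// oppr_ge0 ltW.
- rewrite invrN mulrN -mulNr ler_nM2r ?invr_lt0//.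
  by rewrite -subr_ge0 opprK subrK powR_ge0.
Qed.

(* [kernel_bound] dominates the integrands of all fractional powers below: [K]
   comes from differentiability at 0, [N] from contractivity. *)
Definition kernel_bound (alpha K N : R) (t : R) : R :=
  Order.min (K * t `^ (- alpha)) (N * t `^ (- alpha - 1)).

Lemma kernel_bound_ge0 alpha K N t : 0 <= K -> 0 <= N ->
  0 <= kernel_bound alpha K N t.
Proof. by move=> K0 N0; rewrite /kernel_bound le_min !mulr_ge0// powR_ge0. Qed.

Lemma measurable_kernel_bound alpha K N :
  measurable_fun [set: R] (kernel_bound alpha K N).
Proof. by apply: measurable_minr; exact: measurable_funM. Qed.

(** Monotonicity lets the same function dominate the step functions sampled at right endpoints. *)
Lemma kernel_bound_nincr alpha K N x y : 0 < alpha -> 0 <= K -> 0 <= N ->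
  0 < x -> x <= y -> kernel_bound alpha K N y <= kernel_bound alpha K N x.
Proof.
move=> a0 K0 N0 x0 xy.
have nincr r : 0 <= r -> y `^ (- r) <= x `^ (- r).
  move=> r0; rewrite !powRN lef_pV2 ?posrE ?powR_gt0//.
  - by rewrite ge0_ler_powR// nnegrE ltW// (lt_le_trans x0).
  - exact: lt_le_trans xy.
have n1 := nincr alpha (ltW a0).
have n2 := nincr (alpha + 1) (addr_ge0 (ltW a0) ler01).
rewrite opprD in n2.
by rewrite /kernel_bound le_min !ge_min !ler_wpM2l// orbT.
Qed.

(** Each branch of the minimum is used where its power is integrable: the one with [K] near 0, since
    [alpha < 1], and the one with [N] near infinity, since [0 < alpha]. *)
Lemma integral_kernel_bound_le alpha K N tau : 0 < alpha < 1 ->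
  0 <= K -> 0 <= N -> 0 < tau ->
  (\int[mu]_(t in `]0%R, +oo[) (kernel_bound alpha K N t)%:E
    <= (K * (tau `^ (1 - alpha) / (1 - alpha)) + N * (tau `^ (- alpha) / alpha))%:E)%E.
Proof.
move=> /andP[a0 a1] K0 N0 tau0.
have mg (D : set (measurableTypeR R)) :
    measurable_fun D (EFin \o kernel_bound alpha K N).
  by apply/measurable_EFinP/measurable_funTS; exact: measurable_kernel_bound.
rewrite (@itv_bndbnd_setU _ _ _ (BRight tau)) ?bnd_simp ?(ltW tau0)// ge0_integral_setU//=.
- rewrite EFinD leeD//.
  + apply: (@le_trans _ _ (\int[mu]_(t in `]0%R, tau]) (K%:E * (t `^ (- alpha))%:E)))%E.
      apply: ge0_le_integral => //=.
      * by move=> t _; rewrite lee_fin kernel_bound_ge0.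
      * by apply: measurable_funeM; exact: measurable_EFin_powR.
      * by move=> t _; rewrite -EFinM lee_fin /kernel_bound ge_min lexx.
    rewrite ge0_integralZl_EFin//; last by move=> t _; rewrite lee_fin powR_ge0.
    rewrite EFinM lee_wpmul2l ?lee_fin// addrC.
    by apply: integral_powR_zero; [rewrite addrC subr_gt0|exact: ltW].
  + apply: (@le_trans _ _ (\int[mu]_(t in `[tau, +oo[) (N%:E * (t `^ (- alpha - 1))%:E)))%E.
      rewrite -integral_itv_obnd_cbnd//; last first.
        by apply: measurable_funeM; exact: measurable_EFin_powR.
      apply: ge0_le_integral => //=.
      * by move=> t _; rewrite lee_fin kernel_bound_ge0.
      * by apply: measurable_funeM; exact: measurable_EFin_powR.
      * by move=> t _; rewrite -EFinM lee_fin /kernel_bound ge_min lexx orbT.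
    rewrite ge0_integralZl_EFin//; last by move=> t _; rewrite lee_fin powR_ge0.
    rewrite EFinM lee_wpmul2l ?lee_fin//.
    have := @integral_powR_infty (- alpha - 1) tau.
    by rewrite subrK opprK oppr_lt0; apply.
- by move=> t _; rewrite lee_fin kernel_bound_ge0.
- apply/disj_setPS => t /=; rewrite !in_itv/= => -[/andP[_ h1] /andP[h2 _]].
  by move: (lt_le_trans h2 h1); rewrite ltxx.
Qed.

Lemma integrable_kernel_bound alpha K N : 0 < alpha < 1 -> 0 <= K -> 0 <= N ->
  mu.-integrable `]0%R, +oo[ (EFin \o kernel_bound alpha K N).
Proof.
move=> a01 K0 N0; apply/integrableP; split.
  by apply/measurable_EFinP/measurable_funTS; exact: measurable_kernel_bound.
under eq_integral.
  by move=> t _; rewrite /= ger0_norm ?kernel_bound_ge0//; over.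
by apply: le_lt_trans (integral_kernel_bound_le a01 K0 N0 ltr01) _; rewrite ltry.
Qed.

End power_integrals.

(** * Comparison of two Feller semigroups *)

(* Only approximation from the left and local progress to the right are asked
   for, so that [P] need not hold on an initial segment. *)
Lemma real_induction {R : realType} (P : R -> Prop) (t : R) : 0 <= t -> P 0 ->
  (forall r, 0 < r -> r <= t ->
    (forall e, 0 < e -> exists q, [/\ 0 <= q, r - e < q, q < r & P q]) -> P r) ->
  (forall r, 0 <= r -> r < t -> P r -> exists2 q, r < q & q <= t /\ P q) ->
  P t.
Proof.
move=> t0 P0 limP stepP.
pose S := [set r | [/\ 0 <= r, r <= t & P r]].
have supS : has_sup S by split; [exists 0|exists t => r []].
have S_le r : S r -> r <= sup S by move=> Sr; exact: ub_le_sup supS.2 _ Sr.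
have sup0 : 0 <= sup S by exact: S_le.
have supt : sup S <= t by apply: ge_sup supS.1 _ => r [].
have PS : P (sup S).
  move: sup0; rewrite le_eqVlt => /predU1P[<-//|sup_gt0].
  (* Under the contrary assumption the supremum is not in [S], so the elements of [S] close to it
     lie strictly to its left, as [limP] requires. *)
  apply: contrapT => nP; apply: (nP); apply: limP => // e e0.
  have [q [q0 qt Pq] eq] := sup_adherent e0 supS.
  have := S_le q (And3 q0 qt Pq); rewrite le_eqVlt => /predU1P[qE|qsup].
    by case: nP; rewrite -qE.
  by exists q.
move: supt; rewrite le_eqVlt => /predU1P[<-//|sup_lt].
have [q supq [qt Pq]] := stepP _ sup0 sup_lt PS.
have := S_le q (And3 (le_trans sup0 (ltW supq)) qt Pq).
by rewrite leNgt supq.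
Qed.

Section feller.
Context {R : realType} {X : topologicalType} {T : R -> C0 X R -> C0 X R}.
Hypothesis fellerT : feller_semigroup T.
Implicit Types (f g : C0 X R) (s t : R).

Lemma feller_sub t f g : 0 <= t -> T t (f - g) = T t f - T t g.
Proof.
move=> t0; have := feller_linear fellerT t0 (-1) g f.
by rewrite !scaleN1r [- g + f]addrC => ->; rewrite addrC.
Qed.

Lemma feller_dist t f g : 0 <= t -> `|T t f - T t g| <= `|f - g|.
Proof. by move=> t0; rewrite -feller_sub//; exact: feller_contraction. Qed.

Lemma feller_small f e : 0 < e ->
  exists2 d, 0 < d & forall t, 0 <= t -> t < d -> `|T t f - f| < e.
Proof.
move=> e0; have /cvgrPdist_lt/(_ _ e0) := feller_continuous fellerT f.
move=> [d /= d0 dT]; exists d => // t; rewrite le_eqVlt => /predU1P[<- _|t0 td].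
  by rewrite (feller_id fellerT) subrr normr0.
have := dT t; rewrite /= !sub0r !normrN normr_id gtr0_norm//; exact.
Qed.

Lemma feller_increment s t f : 0 <= s -> s <= t ->
  `|T t f - T s f| <= `|T (t - s) f - f|.
Proof.
move=> s0 st; have -> : T t f = T s (T (t - s) f).
  by rewrite -(feller_add fellerT) ?subr_ge0// addrC subrK.
exact: feller_dist.
Qed.

(** Contractivity spreads right continuity at 0 to a two-sided modulus of continuity, uniform over
    the half-line. *)
Lemma feller_increment_small f e : 0 < e ->
  exists2 d, 0 < d &
    forall s t, 0 <= s -> 0 <= t -> `|t - s| < d -> `|T t f - T s f| < e.
Proof.
move=> e0; have [d d0 dT] := feller_small f e0; exists d => // s t s0 t0.
wlog st : s t s0 t0 / s <= t.
  move=> wl; have [st|/ltW ts] := leP s t; first exact: wl.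
  by move=> tsd; rewrite distrC; apply: wl => //; rewrite distrC.
rewrite ger0_norm ?subr_ge0// => tsd; apply: le_lt_trans (feller_increment _ s0 st) _.
by apply: dT => //; rewrite subr_ge0.
Qed.

Lemma feller_orbit_le2 t f : 0 <= t -> `|T t f - f| <= 2 * `|f|.
Proof.
move=> t0; rewrite (le_trans (ler_normB _ _))// mulr2n mulrDl mul1r lerD2r.
exact: feller_contraction.
Qed.

Lemma generator_small f e : generator_domain T f -> 0 < e ->
  exists2 d, 0 < d & forall t, 0 < t -> t < d ->
    `|T t f - f - t *: generator T f| <= e * t.
Proof.
move=> /cvgrPdist_le/(_ _ _)/[apply] -[d /= d0 dT]; exists d => // t t0 td.
have : `|generator T f - t^-1 *: (T t f - f)| <= e.
  by apply: dT => //=; rewrite sub0r normrN gtr0_norm.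
rewrite distrC -(ler_pM2r t0) -[X in _ * X <= _](gtr0_norm t0) mulrC -normrZ.
by rewrite scalerBr scalerA mulfV ?gt_eqF// scale1r.
Qed.

(** Up to [d] the difference quotient is within 1 of the generator; beyond [d] the bound [2 * |f|]
    is at most [2 * |f| / d * t]. The size of [K] is immaterial, as it only serves integrability. *)
Lemma generator_domain_lipschitz f : generator_domain T f ->
  exists2 K, 0 <= K & forall t, 0 <= t -> `|T t f - f| <= K * t.
Proof.
move=> Df; have [d d0 dT] := generator_small Df ltr01.
exists (`|generator T f| + 1 + 2 * `|f| / d).
  by rewrite !addr_ge0// divr_ge0 ?mulr_ge0// ltW.
move=> t; rewrite le_eqVlt => /predU1P[<-|t0].
  by rewrite (feller_id fellerT) subrr normr0 mulr0.
rewrite mulrDl; have [td|dt] := ltP t d.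
  rewrite ler_wpDr//; first by rewrite !mulr_ge0 ?invr_ge0// ltW.
  rewrite -[X in `|X|](subrK (t *: generator T f)).
  rewrite (le_trans (ler_normD _ _))// normrZ gtr0_norm//.
  by rewrite mulrDl mul1r addrC lerD//; [rewrite mulrC|rewrite -[leRHS]mul1r dT].
rewrite ler_wpDl//; first by rewrite mulr_ge0 ?addr_ge0// ltW.
rewrite (le_trans (feller_orbit_le2 _ (ltW t0)))// -[leRHS]mulrA ler_peMr ?mulr_ge0//.
by rewrite mulrC ler_pdivlMr// mul1r.
Qed.

End feller.

Lemma C0_scaleE {R : realType} {X : topologicalType} a (u : C0 X R) x :
  (a *: u) x = a * u x.
Proof. by []. Qed.

Lemma C0_subE {R : realType} {X : topologicalType} (u v : C0 X R) x :
  (u - v) x = u x - v x.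
Proof. by []. Qed.

Section restriction_linear.
Context {R : realType} {X : topologicalType} {D : set X}.
Hypothesis cD : closed D.
Implicit Types f g : C0 X R.

Lemma C0_restrictB f g :
  C0_restrict D (f - g) = C0_restrict D f - C0_restrict D g.
Proof. by apply: C0_ext => x; rewrite C0_subE !C0_restrictE. Qed.

Lemma C0_restrictZ a f : C0_restrict D (a *: f) = a *: C0_restrict D f.
Proof. by apply: C0_ext => x; rewrite C0_scaleE !C0_restrictE. Qed.

Lemma C0_restrict_norm f : `|C0_restrict D f| <= `|f|.
Proof.
by apply: C0_norm_le => [|x]; rewrite ?C0_restrictE// C0_norm_ub.
Qed.

End restriction_linear.

Section semigroup_comparison.
Context {R : realType} {X : topologicalType} {D : set X}.
Hypothesis cD : closed D.
Context {T : R -> C0 X R -> C0 X R} {S : R -> C0 D R -> C0 D R}.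
Hypotheses (fellerT : feller_semigroup T) (fellerS : feller_semigroup S).
Notation "'pi" := (C0_restrict D).
Implicit Types (f g : C0 X R) (s t r : R).

(** Both orbits are expanded to first order at 0: each remainder costs [e / 2] per unit of time, and
    the difference of the generators costs [L]. *)
Lemma semigroup_defect_small g L e : generator_domain T g ->
  generator_domain S ('pi g) -> 0 < e ->
  `|generator S ('pi g) - 'pi (generator T g)| <= L ->
  exists2 d, 0 < d & forall t, 0 < t -> t < d ->
    `|S t ('pi g) - 'pi (T t g)| <= (L + e) * t.
Proof.
move=> DTg DSg e0 gL; have e20 : 0 < e / 2 by rewrite divr_gt0.
have [d1 d10 Td] := generator_small DTg e20.
have [d2 d20 Sd] := generator_small DSg e20.
exists (Order.min d1 d2); first by rewrite lt_min d10.
move=> t t0; rewrite lt_min => /andP[td1 td2].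
have -> : S t ('pi g) - 'pi (T t g) =
    (S t ('pi g) - 'pi g - t *: generator S ('pi g)) -
    'pi (T t g - g - t *: generator T g) +
    t *: (generator S ('pi g) - 'pi (generator T g)).
  rewrite !C0_restrictB// C0_restrictZ// scalerBr; set a := S t _; set b := 'pi g.
  set c := t *: generator S b; set u := 'pi (T t g); set v := t *: 'pi _.
  (* At a point the identity is one between real numbers, open to [ring]. *)
  apply: C0_ext => x; rewrite -[LHS]/(a x - u x).
  by rewrite -[RHS]/((a x - b x - c x) - (u x - b x - v x) + (c x - v x)); ring.
rewrite mulrDl [leRHS]addrC (le_trans (ler_normD _ _))// lerD//.
  rewrite (le_trans (ler_normB _ _))// [e]splitr mulrDl lerD ?Sd//.
  by rewrite (le_trans (C0_restrict_norm cD _))// Td.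
by rewrite normrZ gtr0_norm// mulrC ler_pM2r.
Qed.

(* Duhamel's formula in differential form: the defect drives the growth of
   r |-> S_(t - r) pi T_r f, which runs from S_t pi f to pi T_t f. *)
Lemma semigroup_comparison f t (L G : R -> R) : 0 <= t ->
  (forall r, 0 <= r -> r <= t -> generator_domain T (T r f)) ->
  (forall r, 0 <= r -> r <= t -> generator_domain S ('pi (T r f))) ->
  (forall r, 0 <= r -> r <= t -> 0 <= L r) ->
  (forall r, 0 <= r -> r <= t ->
    `|generator S ('pi (T r f)) - 'pi (generator T (T r f))| <= L r) ->
  G 0 = 0 ->
  (forall a b, 0 <= a -> a <= b -> b <= t -> L a * (b - a) <= G b - G a) ->
  `|S t ('pi f) - 'pi (T t f)| <= G t.
Proof.
move=> t0 DT DS L0 defect G0 incrG.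
apply/ler_addgt0Pr => e e0.
(* The slack per unit of time, worth at most [e] over [[0, t]]; dividing by [t + 1] also covers
   [t = 0]. *)
have e'0 : 0 < e / (t + 1) by rewrite divr_gt0// ltr_wpDl.
set e' := e / (t + 1) in e'0.
suff : `|S t ('pi f) - 'pi (T t f)| <= G t + e' * t.
  move=> /le_trans; apply; rewrite lerD2l /e' mulrAC ler_pdivrMr ?ltr_wpDl//.
  by rewrite ler_pM2l// lerDl.
pose phi r := S (t - r) ('pi (T r f)).
suff : `|phi 0 - phi t| <= G t + e' * t.
  by rewrite /phi subr0 subrr (feller_id fellerT) (feller_id fellerS).
apply: (@real_induction _ (fun r => `|phi 0 - phi r| <= G r + e' * r)) => //.
- by rewrite subrr normr0 G0 mulr0 addr0.
- move=> r r0 rt near_r; apply/ler_addgt0Pr => e1 e10.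
  have e120 : 0 < e1 / 2 by rewrite divr_gt0.
  have [d1 d10 Td] := feller_increment_small fellerT f e120.
  have [d2 d20 Sd] := feller_increment_small fellerS ('pi (T r f)) e120.
  have [|q [q0 rq qr Pq]] := near_r (Order.min d1 d2); first by rewrite lt_min d10.
  have {rq} : `|r - q| < Order.min d1 d2.
    by rewrite gtr0_norm ?subr_gt0// ltrBlDr addrC -ltrBlDr.
  rewrite lt_min => /andP[rqd1 rqd2].
  rewrite -[X in `|X|](subrKA (phi q)) (le_trans (ler_normD _ _))// lerD//.
    rewrite (le_trans Pq)// lerD//; last by rewrite ler_wpM2l ?ltW.
    rewrite -subr_ge0 (le_trans _ (incrG q r q0 (ltW qr) rt))//.
    by rewrite mulr_ge0 ?subr_ge0 ?L0// ?ltW// (lt_le_trans qr).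
  (* Between [phi q] and [phi r], first the time of [T] moves from [q] to [r], then the time of [S]
     from [t - q] to [t - r]. *)
  rewrite [e1]splitr -(subrKA (S (t - q) ('pi (T r f)))).
  rewrite (le_trans (ler_normD _ _))// lerD//.
    rewrite (le_trans (feller_dist fellerS _ _ _)) ?subr_ge0//.
      exact: le_trans (ltW qr) rt.
    rewrite -C0_restrictB// (le_trans (C0_restrict_norm cD _))//.
    by apply/ltW/Td; rewrite ?(ltW r0)// distrC.
  apply/ltW/Sd; rewrite ?subr_ge0 ?(le_trans (ltW qr) rt)//.
  by rewrite opprB addrC subrKA.
- move=> r r0 rt Pr.
  have [d d0 dd] := semigroup_defect_small (DT r r0 (ltW rt)) (DS r r0 (ltW rt))
    e'0 (defect r r0 (ltW rt)).
  (* Halving [d] makes the step strictly smaller than [d]; the second bound keeps [r + p] within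
     [[0, t]]. *)
  pose p := Order.min (d / 2) (t - r).
  have p0 : 0 < p by rewrite lt_min divr_gt0// subr_gt0.
  have pd : p < d.
    by rewrite gt_min ltr_pdivrMr// ltr_pMr// ltr1n.
  have pt : r + p <= t by rewrite addrC -lerBrDr ge_min lexx orbT.
  exists (r + p); first by rewrite ltrDl.
  split=> //; rewrite -[X in `|X|](subrKA (phi r)) (le_trans (ler_normD _ _))//.
  have : `|phi r - phi (r + p)| <= (L r + e') * p.
    rewrite /phi [r + p]addrC (feller_add fellerT) ?(ltW p0)//.
    (* [S (t - r)] factors as [S (t - (p + r))] after [S p]; contractivity of the outer factor
       leaves the defect of [T r f] over a time [p]. *)
    have -> : t - r = t - (p + r) + p by ring.
    rewrite (feller_add fellerS) ?subr_ge0 ?(ltW p0)//; last by rewrite addrC.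
    rewrite (le_trans (feller_dist fellerS _ _ _)) ?subr_ge0//; last exact: dd.
    by rewrite addrC.
  have := incrG r (r + p) r0 (ltac:(by rewrite lerDl ltW)) pt.
  move: Pr; rewrite [r + p - r]addrC addKr; lra.
Qed.

End semigroup_comparison.

(** * Bochner integrals in [C0] *)

Section simple_functions.
Context {R : realType} {d} {T : measurableType d} {mu : {measure set T -> \bar R}}.
Context {D : set T}.
Hypothesis mD : measurable D.

(** Measurability is expressed through the real functions [|F t - w|] alone, so no sigma-algebra on
    [V] enters. The induction moves one term of the simple function into [F]. *)
Lemma measurable_dist_simple {V : normedModType R} (F : T -> V) s :
  simple_on mu D s ->
  (forall w, measurable_fun D (fun t => `|F t - w|)) ->
  measurable_fun D (fun t => `|F t - simple_eval s t|).
Proof.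
elim: s F => [|[A v] s IHs] F simple_s mF.
  by under eq_fun do rewrite /simple_eval big_nil; exact: mF.
have [mA _ _] := simple_s (A, v) (mem_head _ _).
under eq_fun do rewrite /simple_eval big_cons opprD addrA.
apply: IHs => [Av Avs|w]; first by apply: simple_s; rewrite in_cons Avs orbT.
(* On [A] the subtracted term shifts the centre from [w] to [v + w]; off [A] it vanishes. *)
rewrite (_ : (fun _ => _) = (fun t => \1_A t * `|F t - (v + w)|
                             + (1 - \1_A t) * `|F t - w|)).
  apply: measurable_funD; apply: measurable_funM => //.
  by apply: measurable_funB => //; exact: measurable_indic.
apply/funext => t /=; rewrite indicE; case: (t \in A) => /=.
  by rewrite scale1r subrr mul1r mul0r addr0 opprD addrA.
by rewrite scale0r !subr0 mul1r mul0r add0r.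
Qed.

Context {X : topologicalType}.
Implicit Types (s : seq (set T * C0 X R)) (F : T -> C0 X R) (x : X).

Lemma integral_simple_eval s x : simple_on mu D s ->
  mu.-integrable D (EFin \o (fun t => simple_eval s t x)) /\
  \int[mu]_(t in D) simple_eval s t x = simple_integral mu s x.
Proof.
elim: s => [|[A v] s IHs] simple_s.
  rewrite (_ : (fun _ => _) = cst 0).
    split; first exact: integrable0.
    by rewrite Rintegral_cst// mul0r /simple_integral big_nil.
  by apply/funext => t; rewrite /simple_eval big_nil.
have [mA AD muA] := simple_s (A, v) (mem_head _ _).
have [|is_ intE] := IHs.
  by move=> Av Avs; apply: simple_s; rewrite in_cons Avs orbT.
have iA : mu.-integrable D (EFin \o (\1_A : T -> R)).
  apply/integrableP; split; first by apply/measurable_EFinP; exact: measurable_indic.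
  under eq_integral do rewrite /= ger0_norm//.
  by rewrite integral_indic// setIidl.
have iAv : mu.-integrable D (EFin \o (fun t => (\1_A t : R) * v x)).
  rewrite (_ : _ \o _ = (fun t => (v x)%:E * (EFin \o \1_A) t)%E); last first.
    by apply/funext => t /=; rewrite -EFinM mulrC.
  exact: integrableZl.
rewrite (_ : (fun _ => _) = (fun t => (\1_A t : R) * v x + simple_eval s t x)); last first.
  by apply/funext => t; rewrite /simple_eval big_cons.
split; first exact: (integrableD mD iAv is_).
rewrite RintegralD// intE RintegralZr// /simple_integral big_cons.
by rewrite /Rintegral integral_indic// setIidl.
Qed.

(** Evaluation at [x] is linear and bounded by the norm. The right-hand side is independent of [x],
    which later gives uniform convergence. *)
Lemma simple_integral_dist s F x : simple_on mu D s ->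
  (forall w, measurable_fun D (fun t => `|F t - w|)) ->
  mu.-integrable D (EFin \o (fun t => F t x)) ->
  ((`|\int[mu]_(t in D) F t x - simple_integral mu s x|)%:E
    <= \int[mu]_(t in D) (`|F t - simple_eval s t|)%:E)%E.
Proof.
move=> simple_s mF iF; have [is_ <-] := integral_simple_eval x simple_s.
rewrite -RintegralB// EFin_normr_Rintegral//; last exact: (integrableB mD iF is_).
apply: le_trans (le_abse_integral _ _ _) _ => //.
  by have /integrableP[] := integrableB mD iF is_.
apply: ge0_le_integral => //.
- have /integrableP[+ _] := integrableB mD iF is_.
  by move=> h; apply: measurableT_comp.
- by apply/measurable_EFinP; exact: measurable_dist_simple.
- by move=> t _; rewrite lee_fin; exact: (C0_norm_ub (F t - simple_eval s t) x).
Qed.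

(** Every witness [v] has these values, whichever simple functions approximate [F], so the choice
    made by [bochner_integral] is harmless. *)
Lemma bochner_integral_eval F v x : is_bochner_integral mu D F v ->
  (forall w, measurable_fun D (fun t => `|F t - w|)) ->
  mu.-integrable D (EFin \o (fun t => F t x)) ->
  v x = \int[mu]_(t in D) F t x.
Proof.
move=> [s [simple_s _ s_F s_v]] mF iF; apply/eqP; rewrite -subr_eq0 -normr_le0.
apply/ler_addgt0Pr => e e0; rewrite add0r.
have e20 : 0 < e / 2 by rewrite divr_gt0.
have /cvgrPdist_lt/(_ _ e20) near_v := s_v.
have near_F : \forall n \near \oo,
    (\int[mu]_(t in D) (`|F t - simple_eval (s n) t|)%:E < (e / 2)%:E)%E.
  have e2 : (0 < (e / 2)%:E)%E by rewrite lte_fin.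
  exact: (s_F _ (open_ereal_lt' e2)).
have [n [nv nF]] := @filter_ex _ \oo _ _ (filterI near_v near_F).
rewrite -(subrKA (simple_integral mu (s n) x)) (le_trans (ler_normD _ _))//.
rewrite [leRHS]splitr lerD//.
  by apply: le_trans (ltW nv); exact: (C0_norm_ub (v - simple_integral mu (s n)) x).
rewrite distrC -lee_fin; apply: le_trans (ltW nF).
exact: simple_integral_dist.
Qed.

End simple_functions.

(** Takes the place of a completeness argument: the integral is built as a mere function, and this
    puts it in [C0]. *)
Lemma C0_uniform_limit {R : realType} {X : topologicalType} (h : X -> R) :
  (forall e, 0 < e -> exists u : C0 X R, forall x, `|h x - u x| <= e) -> is_C0 h.
Proof.
move=> unif; split.
- move=> x; apply/cvgrPdist_le => e e0.
  have e30 : 0 < e / 3 by rewrite divr_gt0.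
  have [u hu] := unif _ e30; have [cu _ _] := C0P u.
  have /cvgrPdist_le/(_ _ e30) := cu x; apply: filterS => y uxy.
  have := ler_distD (u x) (h x) (h y); have := ler_distD (u y) (u x) (h y).
  have := hu x; have := hu y; rewrite (distrC (h y)) => hy hx h1 h2.
  by rewrite (le_trans h2)//; move: h1 uxy hy hx; lra.
- have [u hu] := unif _ ltr01; apply/bounded_funE; exists (1 + `|u|) => x.
  rewrite -[h x](subrK (u x)) (le_trans (ler_normD _ _))// lerD//.
  exact: C0_norm_ub.
- move=> e e0; have e20 : 0 < e / 2 by rewrite divr_gt0.
  have [u hu] := unif _ e20; have [_ _ /(_ _ e20)[K cK uK]] := C0P u.
  exists K => // x nKx; rewrite -[h x](subrK (u x)) [e]splitr.
  by rewrite (le_lt_trans (ler_normD _ _))// ler_ltD// uK.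
Qed.

(** * Existence and evaluation of Bochner integrals over the open half-line *)

Section improper_bochner.
Context {R : realType} {X : topologicalType}.
Notation mu := (@lebesgue_measure R).
Notation D := (`]0%R, +oo[%classic : set R).
Implicit Types (F : R -> C0 X R) (g : R -> R).

(** Covers the two 1-Lipschitz functionals in use, distance to a fixed vector and evaluation at a
    point. *)
Lemma measurable_comp_pos F (h : C0 X R -> R) :
  (forall t, 0 < t -> {for t, continuous F}) ->
  (forall u v, `|h u - h v| <= `|u - v|) -> measurable_fun D (h \o F).
Proof.
move=> cF hlip; apply: open_continuous_measurable_fun; first exact: interval_open.
move=> t /set_mem/=; rewrite in_itv/= andbT => t0.
apply/cvgrPdist_lt => e e0; have /cvgrPdist_lt/(_ _ e0) := cF t t0.
by apply: filterS => s; apply: le_lt_trans; exact: hlip.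
Qed.

Lemma measurable_dist_pos F w :
  (forall t, 0 < t -> {for t, continuous F}) -> measurable_fun D (fun t => `|F t - w|).
Proof.
move=> cF; apply: (measurable_comp_pos (h := fun u => `|u - w|)) => // u v.
by rewrite (le_trans (ler_dist_dist _ _))// opprB addrA subrK.
Qed.

Lemma integrable_eval_pos F g x : (forall t, 0 < t -> {for t, continuous F}) ->
  (forall t, 0 < t -> `|F t| <= g t) ->
  mu.-integrable D (EFin \o g) -> mu.-integrable D (EFin \o (fun t => F t x)).
Proof.
move=> cF Fg; apply: le_integrable => //.
  apply/measurable_EFinP.
  apply: (measurable_comp_pos (h := fun u : C0 X R => u x)) => // u v.
  exact: (C0_norm_ub (u - v) x).
move=> t /=; rewrite in_itv/= andbT => t0; rewrite lee_fin.
rewrite (le_trans (C0_norm_ub (F t) x))//.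
by rewrite (le_trans (Fg _ t0))// ler_norm.
Qed.

(** For [k < n.+1 * n.+1] these cells partition []0, n.+1]]: as [n] grows, the mesh shrinks and the
    range exhausts the half-line. *)
Let cell (n k : nat) : set R := `]k%:R / n.+1%:R, k.+1%:R / n.+1%:R]%classic.

(* Right endpoints, so that a nonincreasing bound of [F] also bounds the step
   functions. *)
Definition right_step F (n : nat) : seq (set R * C0 X R) :=
  [seq (cell n k, F (k.+1%:R / n.+1%:R)) | k <- iota 0 (n.+1 * n.+1)].

Lemma right_step_simple F n : simple_on mu D (right_step F n).
Proof.
move=> _ /mapP[k _ ->] /=; split; first exact: measurable_itv.
- move=> t /=; rewrite !in_itv/= andbT => /andP[+ _]; apply: le_lt_trans.
  by rewrite divr_ge0.
- by rewrite lebesgue_measure_itv/=; case: ifP => _; rewrite -?EFinB ltry.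
Qed.

Lemma right_stepE F n t : 0 < t ->
  simple_eval (right_step F n) t = 0 /\ n.+1%:R < t \/
  exists q, [/\ t <= q, q < t + n.+1%:R^-1 & simple_eval (right_step F n) t = F q].
Proof.
move=> t0; have n0 : 0 < n.+1%:R :> R by [].
have evalE : simple_eval (right_step F n) t =
    \sum_(k <- iota 0 (n.+1 * n.+1)) (\1_(cell n k) t : R) *: F (k.+1%:R / n.+1%:R).
  by rewrite /simple_eval big_map.
have [nt|tn] := ltP (n.+1%:R) t.
  left; split=> //; rewrite evalE big1_seq// => k; rewrite mem_iota/= => kn.
  rewrite indicE memNset ?scale0r// /cell/= in_itv/= => /andP[_].
  rewrite leNgt => /negP; apply; apply: le_lt_trans nt.
  by rewrite ler_pdivrMr// -natrM ler_nat.
(* The cell of [t] is the first one whose right end reaches [t]; it exists because the last cell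
   ends at [n.+1]. *)
right; pose P k := t <= k.+1%:R / n.+1%:R.
have exP : exists k, P k.
  exists (n.+1 * n.+1).-1; rewrite /P prednK// natrM mulfK ?gt_eqF//.
have [k Pk kmin] := ex_minnP exP.
have kt : k%:R / n.+1%:R < t.
  case: k kmin {Pk} => [|k] kmin; first by rewrite mul0r.
  by rewrite ltNge; apply/negP => /kmin; rewrite ltnn.
have kn : (k < n.+1 * n.+1)%N.
  by rewrite -(ltr_nat R) natrM -ltr_pdivrMr//; exact: lt_le_trans kt tn.
exists (k.+1%:R / n.+1%:R); split=> //.
  by rewrite -natr1 mulrDl mul1r ltrD2r.
rewrite evalE (bigD1_seq k) ?mem_iota ?iota_uniq//= big1_seq.
  by rewrite addr0 indicE mem_set ?scale1r// /cell/= in_itv/= kt.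
move=> j /andP[jk _]; rewrite indicE memNset ?scale0r// /cell/= in_itv/= => /andP[jt tj].
have jk' : (j < k.+1)%N.
  by rewrite -(ltr_nat R) -(ltr_pM2r (x := n.+1%:R^-1)) ?invr_gt0// (lt_le_trans jt).
have kj' : (k < j.+1)%N.
  by rewrite -(ltr_nat R) -(ltr_pM2r (x := n.+1%:R^-1)) ?invr_gt0// (lt_le_trans kt).
by move: jk; rewrite eqn_leq -ltnS jk' -ltnS kj'.
Qed.

Lemma right_step_cvg F t : (forall t, 0 < t -> {for t, continuous F}) -> 0 < t ->
  simple_eval (right_step F n) t @[n --> \oo] --> F t.
Proof.
move=> cF t0; apply/cvgrPdist_lt => e e0; have /cvgrPdist_lt/(_ _ e0)[d /= d0 dF] := cF t t0.
near=> n.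
have [[_ nt]|[q [tq qt ->]]] := right_stepE F n t0.
  suff : t <= n.+1%:R by rewrite leNgt nt.
  rewrite (@le_trans _ _ n%:R) ?ler_nat//.
  by near: n; exact: nbhs_infty_ger.
apply: dF => /=; rewrite distrC ger0_norm ?subr_ge0// ltrBlDr addrC.
apply: lt_trans qt _; rewrite ltrD2l.
near: n; exact: (near_infty_natSinv_lt (PosNum d0)).
Unshelve. all: by end_near. Qed.

(** Continuity gives pointwise convergence of the step functions, and monotonicity of [g] gives the
    majorant [2 * g]; dominated convergence turns this into convergence in mean. *)
Lemma bochner_integrable_pos F g : (forall t, 0 < t -> {for t, continuous F}) ->
  (forall t, 0 < t -> `|F t| <= g t) ->
  (forall s t, 0 < s -> s <= t -> g t <= g s) ->
  mu.-integrable D (EFin \o g) ->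
  exists v, is_bochner_integral mu D F v.
Proof.
move=> cF Fg g_nincr ig.
have mD : measurable D by exact: measurable_itv.
pose s := right_step F.
have g0 t : 0 < t -> 0 <= g t by move=> t0; exact: le_trans (Fg t t0).
have mdist n : measurable_fun D (fun t => `|F t - simple_eval (s n) t|).
  apply: (measurable_dist_simple (mu := mu)) => // [|w].
    exact: right_step_simple.
  exact: measurable_dist_pos.
have dist_cvg t : 0 < t ->
    (`|F t - simple_eval (s n) t|)%:E @[n --> \oo] --> (0%:E : \bar R).
  move=> t0; apply: cvg_EFin; first exact: nearW.
  have : F t - simple_eval (s n) t @[n --> \oo] --> F t - F t.
    by apply: cvgB; [exact: cvg_cst|exact: right_step_cvg].
  by move/cvg_norm; rewrite subrr normr0.
(* A nonzero step value is [F q] with [t <= q], hence bounded by [g q] and so by [g t]. *)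
have dist_le n t : 0 < t -> `|F t - simple_eval (s n) t| <= 2 * g t.
  move=> t0; rewrite mulr2n mulrDl mul1r (le_trans (ler_normB _ _))// lerD ?Fg//.
  have [[-> _]|[q [tq _ ->]]] := right_stepE F n t0; first by rewrite normr0 g0.
  by rewrite (le_trans (Fg _ (lt_le_trans t0 tq)))// g_nincr.
have int_cvg : (\int[mu]_(t in D) (`|F t - simple_eval (s n) t|)%:E)%E
    @[n --> \oo] --> (0 : \bar R).
  have [] := @dominated_convergence _ _ _ mu D mD
    (fun n t => (`|F t - simple_eval (s n) t|)%:E) (cst 0%E)
    (fun t => 2%:E * (EFin \o g) t)%E.
  - move=> n; apply/measurable_EFinP. exact: mdist.
  - exact: measurable_cst.
  - by apply: aeW => t /=; rewrite in_itv/= andbT; exact: dist_cvg.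
  - exact: integrableZl.
  - apply: aeW => t n /=; rewrite in_itv/= andbT => t0.
    by rewrite -EFinM lee_fin normr_id; exact: dist_le.
  - by move=> _ _; rewrite integral0.
have int_simple n x : ((`|\int[mu]_(t in D) F t x - simple_integral mu (s n) x|)%:E
    <= \int[mu]_(t in D) (`|F t - simple_eval (s n) t|)%:E)%E.
  apply: (simple_integral_dist (mu := mu)) => // [|w|].
  - exact: right_step_simple.
  - exact: measurable_dist_pos.
  - exact: integrable_eval_pos Fg ig.
have unif e : 0 < e -> \forall n \near \oo, forall x,
    `|\int[mu]_(t in D) F t x - simple_integral mu (s n) x| <= e.
  move=> e0; have e0' : (0 < e%:E)%E by rewrite lte_fin.
  have : \forall n \near \oo,
    (\int[mu]_(t in D) (`|F t - simple_eval (s n) t|)%:E < e%:E)%E.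
    exact: (int_cvg _ (open_ereal_lt' e0')).
  apply: filterS => n lt_e x; rewrite -lee_fin.
  exact: le_trans (int_simple n x) (ltW lt_e).
have C0v : is_C0 (fun x => \int[mu]_(t in D) F t x).
  apply: C0_uniform_limit => e e0; have [n hn] := @filter_ex _ \oo _ _ (unif e e0).
  by exists (simple_integral mu (s n)).
exists (MkC0 (asboolT C0v)), s; split => //.
- by move=> n; exact: right_step_simple.
- by apply: aeW => t /=; rewrite in_itv/= andbT; exact: right_step_cvg.
- apply/cvgrPdist_le => e e0; apply: filterS (unif e e0) => n hn.
  by apply: C0_norm_le => //; exact: ltW.
Qed.

Lemma bochner_integral_posE F g x : (forall t, 0 < t -> {for t, continuous F}) ->
  (forall t, 0 < t -> `|F t| <= g t) ->
  (forall s t, 0 < s -> s <= t -> g t <= g s) ->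
  mu.-integrable D (EFin \o g) ->
  bochner_integral mu D F x = \int[mu]_(t in D) F t x.
Proof.
move=> cF Fg g_nincr ig; apply: (bochner_integral_eval (mu := mu)).
- exact: measurable_itv.
(* Existence excludes the default value 0 of [bochner_integral]. *)
- exact: xgetPex (bochner_integrable_pos cF Fg g_nincr ig).
- by move=> w; exact: measurable_dist_pos.
- exact: integrable_eval_pos Fg ig.
Qed.

End improper_bochner.

(** * Fractional powers *)

Lemma powR_kernel_le {R : realType} (alpha K N t b : R) : 0 < t ->
  b <= K * t -> b <= N -> t `^ (- alpha - 1) * b <= kernel_bound alpha K N t.
Proof.
move=> t0 bK bN; rewrite /kernel_bound le_min; apply/andP; split.
  have -> : t `^ (- alpha) = t `^ (- alpha - 1) * t.
    rewrite -[in LHS](subrK 1 (- alpha)) powRD ?(powRr1 (ltW t0))//.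
    by rewrite (gt_eqF t0) implybT.
  by rewrite mulrCA ler_wpM2l ?powR_ge0.
by rewrite [leRHS]mulrC ler_wpM2l ?powR_ge0.
Qed.

Section fractional_integrand.
Context {R : realType} {X : topologicalType} {T : R -> C0 X R -> C0 X R}.
Hypothesis fellerT : feller_semigroup T.
Context {f : C0 X R} (alpha : R).
Hypotheses (DTf : generator_domain T f) (alpha01 : 0 < alpha < 1).
Notation mu := (@lebesgue_measure R).
Notation D := (`]0%R, +oo[%classic : set R).

Let F t := t `^ (- alpha - 1) *: (T t f - f).

Let F_continuous t : 0 < t -> {for t, continuous F}.
Proof.
move=> t0; apply: cvgZ; first exact: powR_continuous_at.
apply: cvgB; last exact: cvg_cst.
apply/cvgrPdist_lt => e e0.
have [d d0 dT] := feller_increment_small fellerT f e0.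
exists (Order.min d t) => [|s /=]; first by rewrite /= lt_min d0.
rewrite lt_min => /andP[sd st]; apply: dT => //; last exact: ltW.
by have := ler_norm (t - s); lra.
Qed.

Let F_le : exists K N, [/\ 0 <= K, 0 <= N &
  forall t, 0 < t -> `|F t| <= kernel_bound alpha K N t].
Proof.
have [K K0 TK] := generator_domain_lipschitz fellerT DTf.
exists K, (2 * `|f|); split=> //.
move=> t t0; rewrite normrZ ger0_norm ?powR_ge0//.
by apply: powR_kernel_le => //; [exact/TK/ltW|exact/feller_orbit_le2/ltW].
Qed.

Lemma fractional_integrand_integrable x :
  mu.-integrable D (EFin \o (fun t => t `^ (- alpha - 1) * (T t f x - f x))).
Proof.
have [K [N [K0 N0 FKN]]] := F_le.
exact: (integrable_eval_pos x F_continuous FKN (integrable_kernel_bound _ _ _)).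
Qed.

Lemma fractional_powerE x : fractional_power T alpha f x =
  (Gamma (- alpha))^-1 *
  \int[mu]_(t in D) (t `^ (- alpha - 1) * (T t f x - f x)).
Proof.
have [K [N [K0 N0 FKN]]] := F_le.
rewrite /fractional_power C0_scaleE; congr (_ * _); apply: (bochner_integral_posE x F_continuous FKN).
- move=> s t s0 st; apply: kernel_bound_nincr => //.
  by case/andP : alpha01.
- exact: integrable_kernel_bound.
Qed.

End fractional_integrand.

(** The Lipschitz estimate is required up to [tau] only, so [K] may depend on [tau], as growth of
    the semigroup on [B] demands. *)
Lemma fractional_power_dist {R : realType} {X : topologicalType} {D : set X}
    (T : R -> C0 X R -> C0 X R) (S : R -> C0 D R -> C0 D R) (f : C0 X R)
    (alpha K N tau : R) : closed D ->
  feller_semigroup T -> feller_semigroup S -> generator_domain T f ->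
  generator_domain S (C0_restrict D f) -> 0 < alpha < 1 -> 0 <= K -> 0 <= N ->
  0 < tau ->
  (forall t, 0 < t -> t <= tau ->
    `|S t (C0_restrict D f) - C0_restrict D (T t f)| <= K * t) ->
  (forall t, 0 < t -> `|S t (C0_restrict D f) - C0_restrict D (T t f)| <= N) ->
  `|fractional_power S alpha (C0_restrict D f)
    - C0_restrict D (fractional_power T alpha f)|
  <= `|(Gamma (- alpha))^-1| *
     (((K * tau + N) / (1 - alpha) + N / alpha) * tau `^ (- alpha)).
Proof.
move=> cD fT fS DTf DSf /[dup] alpha01 /andP[a0 a1] K0 N0 tau0 errK errN.
(* Enlarging the Lipschitz constant makes the small-time bound valid for all
   times, at the cost of a multiple of [N * tau `^ (- alpha)]. *)
pose K' := K + N / tau.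
have K'0 : 0 <= K' by rewrite addr_ge0// divr_ge0// ltW.
have errK' t : 0 < t ->
    `|S t (C0_restrict D f) - C0_restrict D (T t f)| <= K' * t.
  move=> t0; rewrite mulrDl; have [ttau|taut] := leP t tau.
    rewrite (le_trans (errK t t0 ttau))// lerDl mulr_ge0 ?divr_ge0// ltW//.
  rewrite (le_trans (errN t t0))// ler_wpDl ?mulr_ge0 ?(ltW t0)//.
  by rewrite -mulrA ler_peMr// mulrC ler_pdivlMr// mul1r ltW.
(* Here [K' * tau = K * tau + N], so the claimed bound is the split integral for [K'] and [N]. *)
have -> : ((K * tau + N) / (1 - alpha) + N / alpha) * tau `^ (- alpha) =
    K' * (tau `^ (1 - alpha) / (1 - alpha)) + N * (tau `^ (- alpha) / alpha).
  have -> : tau `^ (1 - alpha) = tau * tau `^ (- alpha).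
    by rewrite powRD ?(gt_eqF tau0) ?implybT// powRr1// ltW.
  rewrite /K'; field.
  by rewrite !gt_eqF// subr_gt0.
set bound := _ + _ * _.
have bound0 : 0 <= bound.
  by rewrite addr_ge0// mulr_ge0// divr_ge0 ?powR_ge0 ?subr_ge0// ltW.
apply: C0_norm_le => [|x]; first by rewrite mulr_ge0.
rewrite C0_subE C0_restrictE// !fractional_powerE// -mulrBr normrM ler_wpM2l//.
have iS := fractional_integrand_integrable fS DSf alpha01 x.
have iT := fractional_integrand_integrable fT DTf alpha01 (set_val x).
have mpos : measurable (`]0, +oo[%classic : set (measurableTypeR R)).
  exact: measurable_itv.
rewrite -RintegralB//.
have iB := integrableB mpos iS iT.
rewrite (le_trans (le_normr_Rintegral mpos iB))//.
apply: (@le_trans _ _ (\int[@lebesgue_measure R]_(t in `]0%R, +oo[)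
    kernel_bound alpha K' N t)).
  apply: le_Rintegral => //.
  - exact: (integrable_norm iB).
  - exact: integrable_kernel_bound.
  - move=> t /=; rewrite in_itv/= andbT => t0; rewrite -mulrBr normrM.
    rewrite ger0_norm ?powR_ge0//.
    apply: le_trans (powR_kernel_le alpha t0 (errK' t t0) (errN t t0)).
    rewrite ler_wpM2l ?powR_ge0//.
    apply: le_trans (C0_norm_ub (S t (C0_restrict D f) - C0_restrict D (T t f)) x).
    by rewrite C0_subE !C0_restrictE// opprB addrA subrK.
rewrite /Rintegral -lee_fin fineK.
  exact: integral_kernel_bound_le.
exact: integrable_fin_num (integrable_kernel_bound _ _ _).
Qed.

(** * Error estimates on the normed subspace [B] *)

Section normed_subspaces.
Context {R : realType} {V : normedModType R} {B : set V} {normB : V -> R}.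
Hypothesis nsB : normed_subspace B normB.

Lemma nsub_norm0 : normB 0 = 0.
Proof. by rewrite -(scale0r 0) (nsub_normZ nsB _ (nsub0 nsB)) normr0 mul0r. Qed.

(** Follows from [normB (f - f) <= 2 * normB f], as the norm of 0 is 0. *)
Lemma nsub_norm_ge0 f : B f -> 0 <= normB f.
Proof.
move=> Bf; have := nsub_normD nsB Bf (nsubZ nsB (-1) Bf).
by rewrite scaleN1r subrr nsub_norm0 -scaleN1r (nsub_normZ nsB)// normrN1 mul1r; lra.
Qed.

Lemma opnorm_on_le (S : V -> V) (M : R) f : linear S ->
  (forall g, B g -> B (S g)) ->
  (opnorm_on B normB S <= M%:E)%E -> B f -> normB (S f) <= M * normB f.
Proof.
move=> linS BS SM Bf; have S0 : S 0 = 0.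
  by have := linS (-1) 0 0; rewrite !scaler0 addr0 scaleN1r addNr.
have SZ a g : S (a *: g) = a *: S g by have := linS a g 0; rewrite S0 !addr0.
(* A vector of norm 0 cannot be normalised, but definiteness makes it 0. *)
have [f0|f0] := eqVneq (normB f) 0.
  by rewrite (nsub_norm0_eq0 nsB Bf f0) S0 nsub_norm0 mulr0.
have nf0 : 0 < normB f by rewrite lt_neqAle eq_sym f0 nsub_norm_ge0.
have : ((normB (S ((normB f)^-1 *: f)))%:E <= M%:E)%E.
  apply: le_trans SM; apply: ereal_sup_ubound; exists ((normB f)^-1 *: f) => //.
  split; first exact: (nsubZ nsB _ Bf).
  by rewrite (nsub_normZ nsB)// ger0_norm ?invr_ge0 ?(ltW nf0)// mulVf.
rewrite lee_fin SZ (nsub_normZ nsB _ (BS _ Bf)) ger0_norm ?invr_ge0 ?(ltW nf0)// mulrC.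
by rewrite ler_pdivrMr.
Qed.

End normed_subspaces.

(** On []a, b]] a non-decreasing [c] is at least [c a]. This is the relation between [L] and [G] in
    [semigroup_comparison], for [G] the integral of [c]. *)
Lemma le_Rintegral_ndecr {R : realType} (c : R -> R) (a b : R) :
  {in `[0, +oo[ &, {homo c : x y / x <= y}} ->
  {within `[0, +oo[, continuous c} -> 0 <= a -> a <= b ->
  c a * (b - a) <= \int[@lebesgue_measure R]_(s in `[0%R, b]) c s
                  - \int[@lebesgue_measure R]_(s in `[0%R, a]) c s.
Proof.
move=> c_ndec c_cont a0 ab.
have ic : (@lebesgue_measure R).-integrable `[0, b] (EFin \o c).
  apply: continuous_compact_integrable; first exact: segment_compact.
  by apply: continuous_subspaceW c_cont; exact: subset_itvl.
rewrite Rintegral_itvB//.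
have icab : (@lebesgue_measure R).-integrable `]a, b] (EFin \o c).
  apply: integrableS ic => //; apply: subset_itvr.
  by rewrite bnd_simp.
have -> : c a * (b - a) = \int[@lebesgue_measure R]_(s in `]a, b]) c a.
  rewrite Rintegral_cst//= lebesgue_measure_itv/= lte_fin.
  move: ab; rewrite le_eqVlt => /predU1P[->|ab]; first by rewrite ltxx subrr.
  by rewrite ab -EFinB.
apply: le_Rintegral => //.
  apply/integrableP; split; first exact: measurable_cst.
  rewrite integral_cst//= lebesgue_measure_itv/=.
  by case: ifP => _; rewrite -?EFinB -?EFinM ?mule0 ltry.
move=> x /=; rewrite in_itv/= => /andP[ax xb].
apply: c_ndec; rewrite ?in_itv/= ?andbT//; last exact: ltW.
exact: le_trans a0 (ltW ax).
Qed.

Section approximation.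
Context {R : realType} {X : topologicalType} {D : set X}.
Hypothesis cD : closed D.
Context {T : R -> C0 X R -> C0 X R} {S : R -> C0 D R -> C0 D R}.
Hypotheses (fellerT : feller_semigroup T) (fellerS : feller_semigroup S).
Notation "'pi" := (C0_restrict D).
Context {B : set (C0 X R)} {normB : C0 X R -> R} {w : R}.
Hypotheses (nsB : normed_subspace B normB) (domB : B `<=` generator_domain T)
  (invB : forall t f, 0 <= t -> B f -> B (T t f))
  (domBS : forall f, B f -> generator_domain S ('pi f)) (w0 : 0 <= w)
  (defect : forall f, B f ->
    `|generator S ('pi f) - 'pi (generator T f)| <= w * normB f).
Implicit Types (f g : C0 X R) (s t : R).

(** Invariance of [B] allows the generator estimate at every [T r f], and [G] is monotone, so its
    value at [t] serves all [s] up to [t]. The pair [L], [G] stays open: [c] and its integral for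
    parts 1 and 2, a constant and a linear function for fractional powers. *)
Lemma approximation_le f t (L G : R -> R) : B f -> 0 <= t ->
  (forall r, 0 <= r -> r <= t -> normB (T r f) <= L r) -> G 0 = 0 ->
  (forall a b, 0 <= a -> a <= b -> b <= t -> L a * (b - a) <= G b - G a) ->
  forall s, 0 <= s -> s <= t -> `|S s ('pi f) - 'pi (T s f)| <= w * G t.
Proof.
move=> Bf t0 TL G0 incrG s s0 st.
have L0 r : 0 <= r -> r <= t -> 0 <= L r.
  by move=> r0 rt; apply: le_trans (TL r r0 rt); exact/(nsub_norm_ge0 nsB)/invB.
have Gst : G s <= G t.
  rewrite -subr_ge0 (le_trans _ (incrG s t s0 st (lexx t)))//.
  by rewrite mulr_ge0 ?subr_ge0 ?L0.
apply: le_trans (_ : w * G s <= _); last by rewrite ler_wpM2l.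
apply: (semigroup_comparison cD fellerT fellerS
  (L := fun r => w * L r) (G := fun r => w * G r)) => //.
- by move=> r r0 _; exact/domB/invB.
- by move=> r r0 _; exact/domBS/invB.
- by move=> r r0 rs; rewrite mulr_ge0 ?L0// (le_trans rs).
- move=> r r0 rs; rewrite (le_trans (defect (invB r0 Bf)))// ler_wpM2l// TL//.
  exact: le_trans rs st.
- by rewrite G0 mulr0.
- move=> a b a0 ab bs; rewrite -mulrA -mulrBr ler_wpM2l// incrG//.
  exact: le_trans bs st.
Qed.

(** Replacing [f] by [g] costs [|f - g|] once in each semigroup, since all the maps involved are
    contractions. *)
Lemma approximation_dense_le f g t e : 0 <= t ->
  `|S t ('pi g) - 'pi (T t g)| <= e ->
  `|S t ('pi f) - 'pi (T t f)| <= 2 * `|f - g| + e.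
Proof.
move=> t0 ge.
rewrite -(subrKA (S t ('pi g))) (le_trans (ler_normD _ _))//.
rewrite mulr2n mulrDl mul1r -addrA lerD//.
  rewrite (le_trans (feller_dist fellerS _ _ _))// -C0_restrictB//.
  exact: C0_restrict_norm.
rewrite -(subrKA ('pi (T t g))) (le_trans (ler_normD _ _))// addrC lerD//.
rewrite -C0_restrictB// (le_trans (C0_restrict_norm cD _))// distrC.
exact: feller_dist.
Qed.

Hypothesis normB_ge : forall f, B f -> `|f| <= normB f.

(** On [[0, tau]] the comparison gives the Lipschitz constant [w * (M * normB f)]; [M] may depend on
    [tau]. *)
Lemma fractional_approximation f alpha M tau : B f -> 0 < alpha < 1 ->
  0 <= M -> 0 < tau ->
  (forall s, 0 <= s -> s <= tau -> normB (T s f) <= M * normB f) ->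
  `|fractional_power S alpha ('pi f) - 'pi (fractional_power T alpha f)|
  <= `|(Gamma (- alpha))^-1| *
     ((w * M * tau + 2) / (1 - alpha) + 2 / alpha) * tau `^ (- alpha) * normB f.
Proof.
move=> Bf alpha01 M0 tau0 TM; have nf0 := nsub_norm_ge0 nsB Bf.
apply: le_trans (fractional_power_dist (K := w * (M * normB f))
  (N := 2 * normB f) (tau := tau) cD fellerT fellerS _ _ _ _ _ _ _ _) _ => //.
- exact: domB.
- exact: domBS.
- by rewrite !mulr_ge0.
- by rewrite mulr_ge0.
- move=> t t0 ttau; rewrite -mulrA.
  apply: (approximation_le (L := fun=> M * normB f)
    (G := fun t => M * normB f * t)) => //; rewrite ?ltW//.
  + by move=> r r0 rt; rewrite TM// (le_trans rt).
  + by rewrite mulr0.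
  + by move=> a b _ _ _; rewrite mulrBr.
(* [normB_ge] turns the contraction bound [2 * |f|] into a multiple of [normB f]. *)
- move=> t /ltW t0; rewrite (le_trans (ler_normB _ _))// mulr2n mulrDl mul1r.
  rewrite lerD//.
    rewrite (le_trans (feller_contraction fellerS _ t0))//.
    by rewrite (le_trans (C0_restrict_norm cD _))// normB_ge.
  rewrite (le_trans (C0_restrict_norm cD _))//.
  by rewrite (le_trans (feller_contraction fellerT _ t0))// normB_ge.
- rewrite -!mulrA ler_wpM2l// le_eqVlt; apply/orP; left; apply/eqP.
  rewrite !mulrA; field.
  case/andP : alpha01 => a0 a1; by rewrite !gt_eqF// subr_gt0.
Qed.

End approximation.

Lemma ereal_cvg0 {R : realType} {I : Type} {F : set_system I} {FF : Filter F}
    (u : I -> \bar R) :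
  (forall e, 0 < e -> \forall i \near F, (0 <= u i <= e%:E)%E) ->
  u i @[i --> F] --> 0%E.
Proof.
move=> u0 A [e /= e0 eA]; have e20 : 0 < e / 2 by rewrite divr_gt0.
apply: filterS (u0 _ e20) => i /=; case: (u i) => [r| |] /andP[]//.
rewrite !lee_fin => r0 re; apply: (eA r) => /=; rewrite sub0r normrN ger0_norm//.
by rewrite (le_lt_trans re)// ltr_pdivrMr// ltr_pMr// ltr1n.
Qed.

(** From [1 + x <= expR x]. For exponential growth it bounds what remains of [omega * M' * tau] once
    the exponentials are combined. *)
Lemma mulr_expRN_le {R : realType} (x : R) : x * expR (- x) <= 1.
Proof.
rewrite expRN ler_pdivrMr ?expR_gt0// mul1r.
by have := expR_ge1Dx x; lra.
Qed.

Unset Implicit Arguments.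
Set Strict Implicit.
Set Printing Implicit Defensive.

Theorem theorem2 (R : realType) :
  exists (C1 : R -> R -> R) (C2 C3 : R -> R -> R -> R),
  forall (Omega : metricType R)
    (lcOmega : locally_compact [set: Omega])
    (sepOmega : exists2 S : set Omega, countable S & dense S)
    (Omega_ : R -> set Omega)
    (closedOmega_ : forall h : R, 0 < h -> closed (Omega_ h))
    (T : R -> C0 Omega R -> C0 Omega R)
    (fellerT : feller_semigroup T)
    (B : set (C0 Omega R)) (normB : C0 Omega R -> R)
    (nsB : normed_subspace B normB)
    (denseB : dense B)
    (domB : B `<=` generator_domain T)
    (invB : forall (t : R) (f : C0 Omega R), 0 <= t -> B f -> B (T t f))
    (c : R -> R)
    (c_ndec : {in `[0, +oo[ &, {homo c : x y / x <= y}})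
    (c_cont : {within `[0, +oo[, continuous c})
    (c_bound : forall (t : R) (f : C0 Omega R),
      0 <= t -> B f -> normB (T t f) <= c t * normB f)
    (Th : forall h : R, R -> C0 (Omega_ h) R -> C0 (Omega_ h) R)
    (fellerTh : forall h : R, 0 < h -> feller_semigroup (Th h))
    (pi_ := fun (h : R) (f : C0 Omega R) => C0_restrict (Omega_ h) f)
    (domBh : forall (h : R) (f : C0 Omega R),
      0 < h -> B f -> generator_domain (Th h) (pi_ h f))
    (omega : R -> R)
    (omega01 : forall h : R, 0 < h -> 0 < omega h < 1)
    (omega0 : omega h @[h --> 0^'+] --> (0 : R))
    (gen_approx : forall (h : R) (f : C0 Omega R), 0 < h -> B f ->
      `|generator (Th h) (pi_ h f) - pi_ h (generator T f)|
        <= omega h * normB f)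
    (alpha : R)
    (alpha01 : 0 < alpha < 1)
    (err := fun (h t : R) (f : C0 Omega R) =>
      ereal_sup [set (`|Th h s (pi_ h f) - pi_ h (T s f)|)%:E
                | s in `[0, t]])
    (frac_err := fun (h : R) (f : C0 Omega R) =>
      `|fractional_power (Th h) alpha (pi_ h f)
        - pi_ h (fractional_power T alpha f)|),
  [/\ (* 1 *)
      (forall (t : R) (f : C0 Omega R),
        0 < t -> err h t f @[h --> 0^'+] --> 0%E),
      (* 2 *)
      (forall (f : C0 Omega R) (t h : R), B f -> 0 < t -> 0 < h ->
        (err h t f <=
          (omega h * normB f
            * \int[@lebesgue_measure R]_(s in `[0%R, t]) c s)%:E)%E) &
      (forall f : C0 Omega R, B f -> `|f| <= normB f) ->
      [/\ (* 3 *)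
          (forall (M m : R), 1 <= M -> m <= 0 ->
            (forall t : R, 0 <= t ->
              (opnorm_on B normB (T t) <= (M * expR (m * t))%:E)%E) ->
            forall (f : C0 Omega R) (h : R), B f -> 0 < h ->
              frac_err h f <= C1 M alpha * normB f * omega h `^ alpha),
          (* 4 *)
          (forall (M m : R), 1 <= M -> 0 < m ->
            (forall t : R, 0 <= t ->
              (opnorm_on B normB (T t) <= (M * expR (m * t))%:E)%E) ->
            forall (f : C0 Omega R) (h : R), B f -> 0 < h ->
              frac_err h f
                <= C2 M m alpha * normB f * ln (1 / omega h) `^ (- alpha)) &
          (* 5 *)
          (forall (M p : R), 0 < p ->
            (forall t : R, 0 <= t ->
              (opnorm_on B normB (T t) <= (M * (1 + t `^ p))%:E)%E) ->
            forall (f : C0 Omega R) (h : R), B f -> 0 < h ->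
              frac_err h f
                <= C3 M p alpha * omega h `^ (alpha / (p + 1)) * normB f)]].
Proof.
(* [M], [M / m] and [2 * M] are the bounds of [omega * M' * tau] in the three cases; the power of
   [2 * m] comes from the denominator of [tau] in the second. *)
exists (fun M a => `|(Gamma (- a))^-1| * ((M + 2) / (1 - a) + 2 / a)).
exists (fun M m a => `|(Gamma (- a))^-1| * ((M / m + 2) / (1 - a) + 2 / a)
  * (2 * m) `^ a).
exists (fun M p a => `|(Gamma (- a))^-1| * ((2 * M + 2) / (1 - a) + 2 / a)).
move=> Omega _ _ Omega_ closedOmega_ T fellerT B normB nsB denseB domB invB.
move=> c c_ndec c_cont c_bound Th fellerTh pi_ domBh omega omega01 omega0.
move=> gen_approx alpha alpha01 err frac_err.
have omega_gt0 h : 0 < h -> 0 < omega h by move=> /omega01/andP[].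
pose C t := \int[@lebesgue_measure R]_(s in `[0%R, t]) c s.
have B_err h t s f : 0 < h -> B f -> 0 <= s -> s <= t ->
    `|Th h s (pi_ h f) - pi_ h (T s f)| <= omega h * (normB f * C t).
  move=> h0 Bf s0 st.
  apply: (approximation_le (closedOmega_ h h0) fellerT (fellerTh h h0) nsB domB
    invB (fun g => domBh h g h0) (ltW (omega_gt0 h h0))
    (fun g => gen_approx h g h0) (L := fun r => normB f * c r)
    (G := fun r => normB f * C r)) => //.
  - exact: le_trans st.
  - by move=> r r0 _; rewrite mulrC c_bound.
  - by rewrite /C set_itv1 Rintegral_set1 mulr0.
  - move=> a b a0 ab _; rewrite -mulrA -mulrBr ler_wpM2l ?(nsub_norm_ge0 nsB)//.
    exact: le_Rintegral_ndecr.
split.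
- move=> t f t0; apply: ereal_cvg0 => e e0.
  (* Twice the distance from [f] to [g] then costs at most [e / 2], which leaves [e / 2] for the
     error at [g]. *)
  have e40 : 0 < e / 4 by rewrite divr_gt0.
  have [g [fg Bg]] : (ball f (e / 4) `&` B) !=set0.
    apply: denseB; last exact: ball_open.
    by exists f; exact: ballxx.
  move: fg; rewrite -ball_normE /= => fg.
  have : \forall h \near 0^'+, omega h * (normB g * C t) < e / 2.
    have : omega h * (normB g * C t) @[h --> 0^'+] --> 0 * (normB g * C t).
      by apply: cvgMl.
    rewrite mul0r => /cvgr_lt; apply; by rewrite divr_gt0.
  move=> near_omega; near=> h.
  have h0 : 0 < h by near: h; exact: nbhs_right_gt.
  apply/andP; split.
    (* The supremum is nonnegative because it includes the error at time 0. *)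
    apply: (@le_trans _ _ (`|Th h 0 (pi_ h f) - pi_ h (T 0 f)|)%:E).
      by rewrite lee_fin.
    by apply: ereal_sup_ubound; exists 0 => //=; rewrite in_itv/= lexx ltW.
  apply: ge_ereal_sup => _ [s /= + <-]; rewrite in_itv/= => /andP[s0 st].
  rewrite lee_fin.
  have := approximation_dense_le (closedOmega_ h h0) fellerT (fellerTh h h0)
    f s0 (B_err h t s g h0 Bg s0 st).
  move/le_trans; apply.
  have : omega h * (normB g * C t) < e / 2 by near: h.
  by move: fg; lra.
- move=> f t h Bf t0 h0; apply: ge_ereal_sup => _ [s /= + <-].
  by rewrite in_itv/= => /andP[s0 st]; rewrite lee_fin -mulrA B_err.
move=> normB_ge.
have frac_le h f M tau : 0 < h -> B f -> 0 <= M -> 0 < tau ->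
    (forall s, 0 <= s -> s <= tau -> normB (T s f) <= M * normB f) ->
    frac_err h f <= `|(Gamma (- alpha))^-1| *
      ((omega h * M * tau + 2) / (1 - alpha) + 2 / alpha)
      * tau `^ (- alpha) * normB f.
  move=> h0 Bf M0 tau0 TM.
  exact: (fractional_approximation (closedOmega_ h h0) fellerT (fellerTh h h0)
    nsB domB invB (fun g => domBh h g h0) (ltW (omega_gt0 h h0))
    (fun g => gen_approx h g h0) normB_ge).
have opT q t f : 0 <= t -> (opnorm_on B normB (T t) <= q%:E)%E -> B f ->
    normB (T t f) <= q * normB f.
  move=> t0 Tq Bf; apply: (opnorm_on_le nsB) => //.
  - exact: feller_linear.
  - by move=> g; exact: invB.
split.
- move=> M m M1 m0 TM f h Bf h0; have w0 := omega_gt0 h h0.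
  have M0 : 0 <= M by exact: le_trans M1.
  (* For [m <= 0] the exponential is at most 1, so [M] serves all times and [tau = 1 / omega] makes
     the product equal to [M]. *)
  apply: le_trans (frac_le h f M (omega h)^-1 h0 Bf M0 _ _) _.
  + by rewrite invr_gt0.
  + move=> s s0 _; apply: le_trans (opT _ _ _ s0 (TM s s0) Bf) _.
    rewrite ler_wpM2r ?(nsub_norm_ge0 nsB)// ler_piMr//.
    by rewrite -expR0 ler_expR mulr_le0_ge0.
  + have -> : (omega h)^-1 `^ (- alpha) = omega h `^ alpha.
      by rewrite -(powR_inv1 (ltW w0)) -powRrM mulN1r opprK.
    by rewrite (mulrC (omega h)) mulfK ?gt_eqF// mulrAC.
- move=> M m M1 m0 TM f h Bf h0; have w0 := omega_gt0 h h0.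
  have M0 : 0 <= M by exact: le_trans M1.
  have /andP[_ w1] := omega01 h h0.
  (* With the factor 2, [expR (m * tau)] is only the inverse square root of omega; the other square
     root controls the factor [tau]. *)
  pose tau := ln (1 / omega h) / (2 * m).
  have L0 : 0 < ln (1 / omega h) by rewrite ln_gt0// div1r invf_gt1.
  have tau0 : 0 < tau by rewrite divr_gt0// mulr_gt0.
  have wE : omega h = expR (- (m * tau)) * expR (- (m * tau)).
    rewrite -expRD /tau -opprD.
    have -> : m * (ln (1 / omega h) / (2 * m)) + m * (ln (1 / omega h) / (2 * m))
      = ln (1 / omega h) by field; rewrite gt_eqF.
    by rewrite div1r lnV ?posrE// opprK lnK.
  apply: le_trans (frac_le h f (M * expR (m * tau)) tau h0 Bf _ tau0 _) _.
  + by rewrite mulr_ge0// expR_ge0.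
  + move=> s s0 st; apply: le_trans (opT _ _ _ s0 (TM s s0) Bf) _.
    rewrite ler_wpM2r ?(nsub_norm_ge0 nsB)// ler_wpM2l// ler_expR.
    by rewrite ler_pM2l.
  + have -> : tau `^ (- alpha) =
        (2 * m) `^ alpha * ln (1 / omega h) `^ (- alpha).
      have m20 : 0 <= 2 * m by rewrite mulr_ge0// ltW.
      rewrite /tau powRM ?(ltW L0) ?invr_ge0// mulrC -(powR_inv1 m20) -powRrM.
      by rewrite mulN1r opprK.
    have small : omega h * (M * expR (m * tau)) * tau <= M / m.
      have -> : omega h * (M * expR (m * tau)) * tau =
          M / m * (m * tau * expR (- (m * tau))).
        rewrite wE !expRN; field.
        by rewrite !gt_eqF ?expR_gt0.
      by rewrite ler_piMr ?divr_ge0 ?(ltW m0)// mulr_expRN_le.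
    have /andP[a0 a1] := alpha01.
    rewrite [leRHS]mulrAC ler_wpM2r ?(nsub_norm_ge0 nsB)// -[leRHS]mulrA.
    rewrite ler_wpM2r ?mulr_ge0 ?powR_ge0// ler_wpM2l//.
    by rewrite lerD2r ler_wpM2r ?invr_ge0 ?subr_ge0 ?(ltW a1)// lerD2r.
- move=> M p p0 TM f h Bf h0; have w0 := omega_gt0 h h0.
  have /andP[_ w1] := omega01 h h0.
  have p1 : 0 < p + 1 by rewrite addr_gt0.
  (* The sign of [M] is read off at time 0: the zero vector lies in the unit ball, so the operator
     norm is at least 0. *)
  have M0 : 0 <= M.
    have := TM 0 (lexx _); rewrite powR0 ?gt_eqF// addr0 mulr1 => TM0.
    rewrite -lee_fin; apply: le_trans TM0; apply: ereal_sup_ubound.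
    exists 0; first by split; [exact: nsub0 nsB|rewrite (nsub_norm0 nsB)].
    by rewrite (feller_id fellerT) (nsub_norm0 nsB).
  (* This solves [omega * tau^(p + 1) = 1]. Moreover [tau >= 1], so that [1 + s^p] is at most
     [2 * tau^p] on [[0, tau]], whence the [2 * M]. *)
  pose tau := omega h `^ (- (p + 1)^-1).
  have tau0 : 0 < tau by rewrite powR_gt0.
  have tau1 : 1 <= tau.
    rewrite /tau powRN invf_ge1 ?powR_gt0//.
    apply: (@le_trans _ _ (1 `^ (p + 1)^-1)); last by rewrite powR1.
    by rewrite ge0_ler_powR ?invr_ge0 ?nnegrE ?ltW.
  have tauE : tau `^ (p + 1) = (omega h)^-1.
    by rewrite /tau -powRrM mulNr mulVf ?gt_eqF// powR_inv1 ?ltW.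
  have taup : tau `^ p * tau = (omega h)^-1.
    rewrite -tauE powRD ?(gt_eqF tau0) ?implybT// powRr1//; exact: ltW.
  apply: le_trans (frac_le h f (2 * M * tau `^ p) tau h0 Bf _ tau0 _) _.
  + by rewrite !mulr_ge0 ?powR_ge0.
  + move=> s s0 st; apply: le_trans (opT _ _ _ s0 (TM s s0) Bf) _.
    rewrite ler_wpM2r ?(nsub_norm_ge0 nsB)// mulrAC mulrC ler_wpM2r//.
    have sp : s `^ p <= tau `^ p.
      by rewrite ge0_ler_powR ?nnegrE// ltW.
    have tp : 1 <= tau `^ p.
      apply: (@le_trans _ _ (1 `^ p)); first by rewrite powR1.
      by rewrite ge0_ler_powR ?nnegrE// ltW.
    by move: sp tp; lra.
  + have -> : omega h * (2 * M * tau `^ p) * tau = 2 * M.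
      have -> : omega h * (2 * M * tau `^ p) * tau =
        2 * M * (omega h * (tau `^ p * tau)) by ring.
      by rewrite taup mulfV ?mulr1 ?gt_eqF.
    have -> : tau `^ (- alpha) = omega h `^ (alpha / (p + 1)).
      by rewrite /tau -powRrM mulrNN mulrC.
    exact: lexx.
Unshelve. all: by end_near.
Qed.
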